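(* For any $K, C>0$, there exists an element $\phi\in \mathrm{Out}(\mathbb{F}_n)$ such that any Stallings folding path connecting $R=\phi(R_0)$ to $R_0$ does not yield a $(K,C)$-quasi-geodesic path in $\mathrm{Out}(\mathbb{F}_n)$. That is, for every Stallings folding path $R=x_m\to x_{m-1}\to\dots\to x_0=R_0$, the induced coarse path $\phi=\phi_m,\dots,\phi_0=\mathrm{id}$ in $\mathrm{Out}(\mathbb{F}_n)$ is not a $(K,C)$-quasi-geodesic.
   Context: Let $\mathbb{F}_n=\langle s_1,\dots,s_n\rangle$ be the free group of rank $n$ and $\mathrm{Out}(\mathbb{F}_n)=\mathrm{Aut}(\mathbb{F}_n)/\mathrm{Inn}(\mathbb{F}_n)$. Equip $\mathrm{Out}(\mathbb{F}_n)$ with the word metric $d(\phi,\psi)=\|\phi^{-1}\psi\|$ for the generating set consisting of the right transvections ($s_i\mapsto s_is_k$, fixing the other $s_j$, $k\neq i$), the left transvections ($s_i\mapsto s_ks_i$, fixing the other $s_j$, $k \ne i$), the elements permuting the basis, and the elements sending some $s_i$ to its inverse. A map $p$ from an interval $[0,m]$ (or from the integers in it) to a metric space is a $(K,C)$-quasi-geodesic if $\frac{|i-j|-C}{K}\le d(p(i),p(j))\le K|i-j|+C$ for all $i,j$ in the domain. A labeled graph is a finite connected graph of rank $n$ whose oriented edges are labeled by elements of $\mathbb{F}_n$ (reversing the orientation inverts the label), the labels inducing an isomorphism (marking) from its fundamental group to $\mathbb{F}_n$, defined up to conjugation and graph automorphism. $R_0$ is the rose with $n$ petals labeled $s_1,\dots,s_n$,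 and $\phi(R_0)$ is the rose with petals labeled $\phi(s_1),\dots,\phi(s_n)$. Subdivide the edges of a labeled graph into edgelets, each labeled by some $s_j^{\pm1}$, so that the concatenation of the edgelets along an edge gives the original label of the edge. A marking-directed fold is a quotient map identifying two edgelets that have the same origin vertex and the same label; the quotient is again a labeled graph and the quotient map is a homotopy equivalence respecting the markings. A Stallings folding path from $x$ to $R_0$ is a finite sequence of marking-directed folds $x=x_m\to x_{m-1}\to\dots\to x_1\to x_0=R_0$. Such a path induces a coarse path in $\mathrm{Out}(\mathbb{F}_n)$ as follows. For each $0<i\le m$ collapse a spanning tree of $x_i$ to obtain a rose, and identify this rose with $R_0$ by some graph isomorphism; $\phi_i$ is the outer automorphism sending $s_j$ to the label in $\mathbb{F}_n$ (read through the composition of folds $x_i\to R_0$) of the loop of $x_i$ corresponding to the $j$-th petal. Moreover $\phi_0=\mathrm{id}$ and $\phi_m=\phi$. The map $\phi_i$ is coarsely well defined: different choices of spanning trees and identifications change $\phi_i$ by a uniformly bounded distance.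
   Formalization: The rank n is assumed to be at least 2; for n = 0 or 1 the group Out(F_n) is finite (order 1 or 2) and the claim fails for large C, since short folding paths are then (K,C)-quasi-geodesics. *)

(* Defs.v *)
From HB Require Import structures.
From mathcomp Require Import all_boot all_order all_algebra perm.
From mathcomp Require Import boolp classical_sets reals.

Set Implicit Arguments.
Unset Strict Implicit.
Unset Printing Implicit Defensive.

Import Order.TTheory GRing.Theory Num.Theory.

Local Open Scope group_scope.
Local Open Scope quotient_scope.

(* Words are taken in S and in the inverses of elements of S. Outside of the
   subgroup generated by S the value is the junk value inf set0 = 0; this does
   not occur for out_generators, which generate Out(F_n) (Nielsen). *)
Definition word_norm (R : realType) (G : groupType) (S : set G) (g : G) : R :=
  inf [set r : R | exists w : seq G,
    [/\ forall s, s \in w -> S s \/ S s^-1,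
        \prod_(s <- w) s = g & r = ((size w)%:R)%R]]%classic.

Definition word_dist (R : realType) (G : groupType) (S : set G) (g h : G) : R :=
  word_norm R S (g^-1 * h).

Definition quasi_geodesic (R : realType) (T : Type) (d : T -> T -> R)
    (K C : R) (m : nat) (p : nat -> T) : Prop :=
  forall i j, (i <= m)%N -> (j <= m)%N ->
    ((`|i%:R - j%:R| - C) / K <= d (p i) (p j) <= K * `|i%:R - j%:R| + C)%R.

Definition is_automorphism (G : groupType) (f : G -> G) : Prop :=
  {morph f : x y / x * y} /\ bijective f.

Section Aut.
Variable G : groupType.

Record autom := Autom {
  autom_fun :> G -> G;
  autom_subproof : `[< is_automorphism autom_fun >]
}.

HB.instance Definition _ := [isSub for autom_fun].
HB.instance Definition _ := [Choice of autom by <:].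

Lemma automP (f : autom) : is_automorphism f.
Proof. exact/asboolP/autom_subproof. Qed.

Lemma automM (f : autom) : {morph f : x y / x * y}.
Proof. exact: (automP f).1. Qed.

Lemma autom_eqP (f g : autom) : f =1 g -> f = g.
Proof. by move=> fg; apply/val_inj/funext. Qed.

Lemma autom_id_subproof : `[< is_automorphism (@id G) >].
Proof. by apply/asboolP; split=> //; exists id. Qed.
Definition autom_id := Autom autom_id_subproof.

Lemma autom_comp_subproof (f g : autom) : `[< is_automorphism (f \o g) >].
Proof.
apply/asboolP; split; first by move=> x y /=; rewrite !automM.
exact: bij_comp (automP f).2 (automP g).2.
Qed.
Definition autom_comp (f g : autom) : autom := Autom (autom_comp_subproof f g).

Lemma autom_inv_ex (f : autom) : exists g : autom, cancel f g /\ cancel g f.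
Proof.
have [fM [g fK gK]] := automP f.
suff gP : `[< is_automorphism g >] by exists (Autom gP).
apply/asboolP; split; last by exists f.
by move=> x y; apply: (canLR fK); rewrite fM !gK.
Qed.
Definition autom_inv (f : autom) : autom := sval (cid (autom_inv_ex f)).

Lemma autom_invK (f : autom) : cancel f (autom_inv f) /\ cancel (autom_inv f) f.
Proof. exact: svalP (cid (autom_inv_ex f)). Qed.

Lemma autom_compA : associative autom_comp.
Proof. by move=> f g h; apply: autom_eqP. Qed.
Lemma autom_comp1f : left_id autom_id autom_comp.
Proof. by move=> f; apply: autom_eqP. Qed.
Lemma autom_compf1 : right_id autom_id autom_comp.
Proof. by move=> f; apply: autom_eqP. Qed.
Lemma autom_compVf : left_inverse autom_id autom_inv autom_comp.
Proof. by move=> f; apply: autom_eqP => x /=; rewrite (autom_invK f).1. Qed.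
Lemma autom_compfV : right_inverse autom_id autom_inv autom_comp.
Proof. by move=> f; apply: autom_eqP => x /=; rewrite (autom_invK f).2. Qed.

(* f * g is f \o g. *)
HB.instance Definition _ := isGroup.Build autom
  autom_compA autom_comp1f autom_compf1 autom_compVf autom_compfV.

Lemma automME (f g : autom) x : (f * g) x = f (g x).
Proof. by []. Qed.

Lemma autom1 (f : autom) : f 1 = 1.
Proof. by apply: (mulgI (f 1)); rewrite -automM !mulg1. Qed.

Lemma automV (f : autom) x : f x^-1 = (f x)^-1.
Proof. by apply: (mulgI (f x)); rewrite -automM !mulgV autom1. Qed.

Lemma automJ (f : autom) x c : f (x ^ c) = f x ^ f c.
Proof. by rewrite /conjg !automM automV. Qed.

Definition inner_equiv (f g : autom) : bool :=
  `[< exists c : G, forall x, f x = g x ^ c >].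

Lemma inner_equiv_refl : reflexive inner_equiv.
Proof. by move=> f; apply/asboolP; exists 1 => x; rewrite conjg1. Qed.

Lemma inner_equiv_sym : symmetric inner_equiv.
Proof.
suff H (f g : autom) : inner_equiv f g -> inner_equiv g f by move=> f g; apply/idP/idP; apply: H.
by move=> /asboolP[c fg]; apply/asboolP; exists c^-1 => x; rewrite fg conjgK.
Qed.

Lemma inner_equiv_trans : transitive inner_equiv.
Proof.
move=> g f h /asboolP[c fg] /asboolP[d gh]; apply/asboolP; exists (d * c) => x.
by rewrite fg gh conjgM.
Qed.

Canonical inner_equiv_rel :=
  EquivRel inner_equiv inner_equiv_refl inner_equiv_sym inner_equiv_trans.

Definition Out := {eq_quot inner_equiv_rel}.
HB.instance Definition _ := Choice.on Out.
HB.instance Definition _ := EqQuotient.on Out.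

Definition out (f : autom) : Out := \pi_Out f.

Lemma out_eqP (f g : autom) :
  out f = out g <-> exists c : G, forall x, f x = g x ^ c.
Proof.
split=> [/eqmodP/asboolP//|fg]; apply/eqmodP; exact/asboolP.
Qed.

Lemma outK (a : Out) : out (repr a) = a.
Proof. exact: reprK. Qed.

Definition out_mul (a b : Out) : Out := out (repr a * repr b).
Definition out_inv (a : Out) : Out := out (repr a)^-1.

Lemma out_mulE (f g : autom) : out_mul (out f) (out g) = out (f * g).
Proof.
have /out_eqP[c fE] := outK (out f); have /out_eqP[d gE] := outK (out g).
apply/out_eqP; exists (f d * c) => x.
by rewrite !automME fE gE automJ conjgM.
Qed.

Lemma out_invE (f : autom) : out_inv (out f) = out f^-1.
Proof.
have /out_eqP[c fE] := outK (out f).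
set h := repr _ in fE *; apply/out_eqP; exists (f^-1 c)^-1 => x.
have hK y : h^-1 (h y) = y by rewrite -automME mulVg.
have fK y : f (f^-1 y) = y by rewrite -automME mulgV.
rewrite -[RHS]hK; congr (h^-1 _).
by rewrite fE automJ automV !fK conjgKV.
Qed.

Lemma out_mulA : associative out_mul.
Proof.
by move=> a b c; rewrite -(outK a) -(outK b) -(outK c) !out_mulE mulgA.
Qed.
Lemma out_mul1a : left_id (out 1) out_mul.
Proof. by move=> a; rewrite -(outK a) out_mulE mul1g. Qed.
Lemma out_mula1 : right_id (out 1) out_mul.
Proof. by move=> a; rewrite -(outK a) out_mulE mulg1. Qed.
Lemma out_mulVa : left_inverse (out 1) out_inv out_mul.
Proof. by move=> a; rewrite -(outK a) out_invE out_mulE mulVg. Qed.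
Lemma out_mulaV : right_inverse (out 1) out_inv out_mul.
Proof. by move=> a; rewrite -(outK a) out_invE out_mulE mulgV. Qed.

HB.instance Definition _ := isGroup.Build Out
  out_mulA out_mul1a out_mula1 out_mulVa out_mulaV.

Lemma outM (f g : autom) : out (f * g) = out f * out g.
Proof. by rewrite -out_mulE. Qed.
Lemma outV (f : autom) : out f^-1 = (out f)^-1.
Proof. by rewrite -out_invE. Qed.
Lemma out1 : out 1 = 1. Proof. by []. Qed.

End Aut.

(* (i, false) is s_i and (i, true) is its inverse. *)
Definition letter (n : nat) := ('I_n * bool)%type.

Definition linv n (a : letter n) : letter n := (a.1, ~~ a.2).

Lemma linvK n : involutive (@linv n).
Proof. by case=> i b; rewrite /linv negbK. Qed.

Definition reduced_word n (w : seq (letter n)) : bool :=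
  sorted (fun a b => b != linv a) w.

Section FreeGroup.
Variable n : nat.
Implicit Types (a b : letter n) (u v w : seq (letter n)).

Record free_group := FreeGroup {
  fg_word :> seq (letter n);
  fg_word_reduced : reduced_word fg_word
}.

HB.instance Definition _ := [isSub for fg_word].
HB.instance Definition _ := [Countable of free_group by <:].

Definition cons_word a w : seq (letter n) :=
  if w is b :: w' then if b == linv a then w' else a :: w else [:: a].

Definition mul_word u v : seq (letter n) := foldr cons_word v u.

Definition inv_word w : seq (letter n) := rev (map (@linv n) w).

Lemma reduced_cons_word a w : reduced_word w -> reduced_word (cons_word a w).
Proof.
case: w => // b w; rewrite /cons_word /reduced_word.
by case: ifPn => [_|nb] /= bw; [exact: path_sorted bw | rewrite nb].
Qed.

Lemma reduced_mul_word u v : reduced_word v -> reduced_word (mul_word u v).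
Proof. by move=> rv; elim: u => //= a u; apply: reduced_cons_word. Qed.

Lemma reduced_inv_word w : reduced_word w -> reduced_word (inv_word w).
Proof.
rewrite /reduced_word /inv_word rev_sorted sorted_map.
apply: sub_sorted => a b /=; apply: contraNneq => ab.
by rewrite ab linvK.
Qed.

Lemma cons_wordK a w : reduced_word w ->
  cons_word a (cons_word (linv a) w) = w.
Proof.
case: w => [|b w] /=; first by rewrite eqxx.
rewrite linvK; case: eqP => [-> |_ _] /=; last by rewrite eqxx.
by case: w => //= c w /andP[/negPf->].
Qed.

Lemma mul_word_cons a u w : reduced_word u -> reduced_word w ->
  mul_word (cons_word a u) w = cons_word a (mul_word u w).
Proof.
case: u => //= b u ru rw; case: eqP => [->|//].
by rewrite /= cons_wordK // reduced_mul_word.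
Qed.

Lemma mul_wordA u v w : reduced_word v -> reduced_word w ->
  mul_word u (mul_word v w) = mul_word (mul_word u v) w.
Proof.
move=> rv rw; elim: u => //= a u ->.
by rewrite mul_word_cons ?reduced_mul_word.
Qed.

Lemma mul_word_nil w : reduced_word w -> mul_word w [::] = w.
Proof.
elim: w => //= a w IH aw; rewrite IH; last exact: path_sorted aw.
by case: w aw {IH} => //= b w /andP[/negPf->].
Qed.

Lemma mul_word_inv w : mul_word (inv_word w) w = [::].
Proof.
rewrite /inv_word; elim: w => //= a w IH.
by rewrite rev_cons -cats1 /mul_word foldr_cat /= linvK eqxx.
Qed.

Lemma inv_wordK w : inv_word (inv_word w) = w.
Proof. by rewrite /inv_word map_rev revK mapK //; exact: linvK. Qed.

Definition fg_one := FreeGroup (isT : reduced_word [::]).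
Definition fg_mul (x y : free_group) :=
  FreeGroup (reduced_mul_word x (fg_word_reduced y)).
Definition fg_inv (x : free_group) :=
  FreeGroup (reduced_inv_word (fg_word_reduced x)).

Lemma fg_mulA : associative fg_mul.
Proof. by move=> x y z; apply/val_inj/mul_wordA; apply: fg_word_reduced. Qed.
Lemma fg_mul1x : left_id fg_one fg_mul.
Proof. by move=> x; apply: val_inj. Qed.
Lemma fg_mulx1 : right_id fg_one fg_mul.
Proof. by move=> x; apply/val_inj/mul_word_nil/fg_word_reduced. Qed.
Lemma fg_mulVx : left_inverse fg_one fg_inv fg_mul.
Proof. by move=> x; apply/val_inj/mul_word_inv. Qed.
Lemma fg_mulxV : right_inverse fg_one fg_inv fg_mul.
Proof.
by move=> x; apply/val_inj; rewrite /= -{1}[fg_word x]inv_wordK mul_word_inv.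
Qed.

HB.instance Definition _ := isGroup.Build free_group
  fg_mulA fg_mul1x fg_mulx1 fg_mulVx fg_mulxV.

Definition gen (i : 'I_n) : free_group :=
  FreeGroup (isT : reduced_word [:: (i, false)]).

End FreeGroup.

Definition right_transvection n (f : autom (free_group n)) : Prop :=
  exists i k, [/\ k != i, f (gen i) = gen i * gen k &
    forall j, j != i -> f (gen j) = gen j].

Definition left_transvection n (f : autom (free_group n)) : Prop :=
  exists i k, [/\ k != i, f (gen i) = gen k * gen i &
    forall j, j != i -> f (gen j) = gen j].

Definition basis_permutation n (f : autom (free_group n)) : Prop :=
  exists s : {perm 'I_n}, forall j, f (gen j) = gen (s j).

Definition basis_inversion n (f : autom (free_group n)) : Prop :=
  exists i, f (gen i) = (gen i)^-1 /\ forall j, j != i -> f (gen j) = gen j.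

Definition out_generators n : set (Out (free_group n)) :=
  [set a | exists2 f : autom (free_group n), a = out f &
    [\/ right_transvection f, left_transvection f,
        basis_permutation f | basis_inversion f]]%classic.

Definition out_dist (R : realType) n (phi psi : Out (free_group n)) : R :=
  word_dist R (@out_generators n) phi psi.

Record lgraph (n : nat) := LGraph {
  vertex : finType;
  edge : finType;
  org : edge -> vertex;
  erev : edge -> edge;
  lab : edge -> free_group n;
  erevK : involutive erev;
  erev_neq : forall e, erev e != e;
  lab_erev : forall e, lab (erev e) = (lab e)^-1
}.

Definition tgt n (x : lgraph n) (e : edge x) : vertex x := org (erev e).

Fixpoint walk n (x : lgraph n) (u : vertex x) (p : seq (edge x))
    (v : vertex x) : bool :=
  if p is e :: p' then (org e == u) && walk (tgt e) p' v else u == v.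

Definition reduced n (x : lgraph n) (p : seq (edge x)) : bool :=
  sorted (fun a b => b != erev a) p.

Definition walk_label n (x : lgraph n) (p : seq (edge x)) : free_group n :=
  \prod_(e <- p) lab e.

(* Elements of pi_1(x, v) are the reduced closed walks at v, so the second
   clause says that the labels induce an isomorphism pi_1(x, v) -> F_n; in
   particular x has rank n. *)
Definition labeled_graph n (x : lgraph n) : Prop :=
  [/\ (0 < #|vertex x|)%N,
      forall v (g : free_group n), exists! p : seq (edge x),
        [/\ walk v p v, reduced p & walk_label p = g] &
      forall u v : vertex x, exists p, walk u p v].

Record lgraph_iso n (x y : lgraph n) (fV : vertex x -> vertex y)
    (fE : edge x -> edge y) : Prop := {
  iso_bijV : bijective fV;
  iso_bijE : bijective fE;
  iso_org : forall e, org (fE e) = fV (org e);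
  iso_erev : forall e, erev (fE e) = fE (erev e);
  iso_lab : forall e, lab (fE e) = lab e
}.

Definition isomorphic n (x y : lgraph n) : Prop :=
  exists fV fE, @lgraph_iso n x y fV fE.

Section Rose.
Variables (n : nat) (f : autom (free_group n)).

Definition rose_lab (a : letter n) : free_group n :=
  if a.2 then (f (gen a.1))^-1 else f (gen a.1).

Lemma linv_neq (a : letter n) : linv a != a.
Proof. by case: a => i []; rewrite /linv xpair_eqE eqxx. Qed.

Lemma rose_lab_linv a : rose_lab (linv a) = (rose_lab a)^-1.
Proof. by case: a => i []; rewrite /rose_lab /= ?invgK. Qed.

Definition rose : lgraph n :=
  @LGraph n unit (letter n) (fun=> tt) (@linv n) rose_lab
    (@linvK n) linv_neq rose_lab_linv.

End Rose.

Definition R0 n : lgraph n := rose (1 : autom (free_group n)).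

(* All edges are edgelets: their labels are the s_j and their inverses. *)
Definition edgelet_graph n (y : lgraph n) : Prop :=
  forall e : edge y, exists j, lab e = gen j \/ lab e = (gen j)^-1.

(* y is obtained from x by cutting every edge e into the walk sE e; sV is the
   inclusion of the vertices of x. As every edgelet is used exactly once, the
   last two clauses say that the interior vertices of the walks sE e are new
   and pairwise distinct (up to reversing e), and that there is no other new
   vertex. The edgelet labels along e only have to multiply to lab e: they may
   spell an unreduced word. *)
Record subdivision n (x y : lgraph n) (sV : vertex x -> vertex y)
    (sE : edge x -> seq (edge y)) : Prop := {
  sub_inj : injective sV;
  sub_walk : forall e, walk (sV (org e)) (sE e) (sV (tgt e));
  sub_neq0 : forall e, sE e != [::];
  sub_erev : forall e, sE (erev e) = rev (map (@erev n y) (sE e));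
  sub_lab : forall e, walk_label (sE e) = lab e;
  sub_once : forall a : edge y, (\sum_(e : edge x) count_mem a (sE e))%N = 1%N;
  sub_interior : forall e p q, sE e = p ++ q -> p != [::] -> q != [::] ->
    forall u v, walk (sV (org e)) p v -> v != sV u;
  sub_valence : forall v : vertex y, (forall u, v != sV u) ->
    #|[pred a : edge y | org a == v]| = 2
}.

Definition edgelet_subdivision n (x y : lgraph n) : Prop :=
  edgelet_graph y /\ exists sV sE, @subdivision n x y sV sE.

Definition same_pair (T : eqType) (a b c d : T) : bool :=
  [|| (a == c) && (b == d) | (a == d) && (b == c)].

(* (fV, fE) presents y as the quotient of x that identifies e1 with e2, and
   nothing else than what is forced by this: erev e1 with erev e2 and the
   terminal vertices. *)
Record fold_map n (x y : lgraph n) (e1 e2 : edge x) (fV : vertex x -> vertex y)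
    (fE : edge x -> edge y) : Prop := {
  fold_neq : e1 != e2;
  fold_same_org : org e1 = org e2;
  fold_same_lab : lab e1 = lab e2;
  fold_org : forall e, org (fE e) = fV (org e);
  fold_erev : forall e, erev (fE e) = fE (erev e);
  fold_lab : forall e, lab (fE e) = lab e;
  fold_surjV : forall v, exists u, fV u = v;
  fold_surjE : forall a, exists e, fE e = a;
  fold_eqV : forall u v, (fV u == fV v) =
    (u == v) || same_pair u v (tgt e1) (tgt e2);
  fold_eqE : forall a b, (fE a == fE b) =
    [|| a == b, same_pair a b e1 e2 | same_pair a b (erev e1) (erev e2)]
}.

(* A fold preserves the labels, hence respects the markings; as both graphs are
   marked by their labels, it is a homotopy equivalence. *)
Definition fold n (x y : lgraph n) : Prop :=
  [/\ labeled_graph x, labeled_graph y, edgelet_graph x &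
      exists e1 e2 fV fE, @fold_map n x y e1 e2 fV fE].

(* x m -> x (m - 1) -> ... -> x 0 = R0, where x m is phi(R0) with its edges
   subdivided. The labels of phi(R0) are defined up to conjugation, so any
   automorphism f in the class phi may be used. *)
Definition stallings_folding_path n (phi : Out (free_group n)) (m : nat)
    (x : nat -> lgraph n) : Prop :=
  [/\ exists2 f, out f = phi & edgelet_subdivision (rose f) (x m),
      forall i, (i < m)%N -> fold (x i.+1) (x i) &
      isomorphic (x 0%N) (R0 n)].

Definition spanning_tree n (x : lgraph n) (T : {set edge x}) : Prop :=
  [/\ forall e, (erev e \in T) = (e \in T),
      forall u v : vertex x, exists2 p, walk u p v & {subset p <= T} &
      forall v p, walk v p v -> {subset p <= T} -> reduced p -> p = [::]].

(* The edges of the rose x / T are the edges of x outside of T. *)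
Definition petal_identification n (x : lgraph n) (T : {set edge x})
    (h : letter n -> edge x) : Prop :=
  [/\ injective h, forall a, h (linv a) = erev (h a) &
      forall e, (e \notin T) <-> exists a, h a = e].

(* Folds preserve the labels, so reading the label of a loop of x through the
   folds x -> R0 is reading it in x. *)
Definition petal_loop n (x : lgraph n) (T : {set edge x}) (v : vertex x)
    (e : edge x) (p : seq (edge x)) : Prop :=
  exists a b, [/\ p = a ++ e :: b, walk v p v, {subset a <= T} & {subset b <= T}].

Definition induced_out n (x : lgraph n) (phi : Out (free_group n)) : Prop :=
  exists (T : {set edge x}) (v : vertex x) (h : letter n -> edge x) f,
    [/\ spanning_tree T, petal_identification T h, out f = phi &
      forall j, exists2 p, petal_loop T v (h (j, false)) p &
        f (gen j) = walk_label p].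

Definition induced_path n (phi : Out (free_group n)) (m : nat)
    (x : nat -> lgraph n) (p : nat -> Out (free_group n)) : Prop :=
  [/\ p 0%N = 1, p m = phi &
      forall i, (0 < i <= m)%N -> induced_out (x i) (p i)].

(* Main.v *)
Require Import Defs.
From mathcomp Require Import all_boot all_order all_algebra reals.
From mathcomp Require Import boolp classical_sets zify lra.
Set Implicit Arguments.
Unset Strict Implicit.
Unset Printing Implicit Defensive.

Import Order.TTheory GRing.Theory Num.Theory.
Local Open Scope ring_scope.

(** Each fold identifies one pair of edgelets, so it lowers the number of
    oriented edgelets by at most two, whereas [R0] has [2 n] of them; a folding
    path of length [m] therefore starts at a graph with at most [2 (m + n)]
    oriented edgelets ([folding_path_length]).  That graph subdivides
    [phi(R0)], so it has at least as many edgelets as the cyclically reduced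
    length of any [phi (s_j)].  Hence [m] grows at least like the stretching of
    conjugacy classes by [phi].

    Word length in [Out(F_n)] does not see this stretching: the powers of
    [psi : s_i |-> s_i s_j, s_j |-> s_j s_i s_j], a product of two
    transvections, satisfy [||psi ^ k|| <= 2 k], while [psi ^ k (s_i)] is
    exponentially long.  A [(K, C)]-quasi-geodesic from [psi ^ k] to [1] has
    length at most [2 k K + C], so for large [k] no folding path is one.

    Conjugacy length is bounded below by the exponent sum, the homomorphism
    [F_n -> Z] with every [s_j |-> 1]: it is invariant under conjugation, which
    takes care of the choice of the automorphism that represents [phi], and it
    is at most the number of edgelets of any walk ([exponent_sum_walk]). *)

(** * Homomorphisms out of the free group *)

Lemma morph_group1V (G H : groupType) (h : G -> H) :
  {morph h : x y / (x * y)%g} -> h 1%g = 1%g /\ {morph h : x / (x^-1)%g}.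
Proof.
move=> hM.
have h1 : h 1%g = 1%g by apply: (mulgI (h 1%g)); rewrite -hM !mulg1.
by split=> // x; apply: (mulgI (h x)); rewrite -hM !mulgV.
Qed.

Section UniversalProperty.
Local Open Scope group_scope.
Variables (n : nat) (G : groupType) (g : 'I_n -> G).

Definition letter_image (a : letter n) : G := if a.2 then (g a.1)^-1 else g a.1.

Definition free_lift (x : free_group n) : G := \prod_(a <- fg_word x) letter_image a.

Lemma letter_image_linv a : letter_image (linv a) = (letter_image a)^-1.
Proof. by case: a => i []; rewrite /letter_image /= ?invgK. Qed.

Lemma free_liftM : {morph free_lift : x y / x * y}.
Proof.
move=> x y; rewrite /free_lift /=; elim: (fg_word x) => [|a u IH] /=.
  by rewrite big_nil mul1g.
rewrite big_cons -mulgA -IH; case: (mul_word u y) => [|b w] /=.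
  by rewrite big_seq1 big_nil mulg1.
case: eqP => [->|_]; last by rewrite big_cons.
by rewrite big_cons letter_image_linv mulgA mulgV mul1g.
Qed.

Lemma free_lift_gen i : free_lift (gen i) = g i.
Proof. by rewrite /free_lift /= big_seq1. Qed.

End UniversalProperty.

Section FreeMorphisms.
Local Open Scope group_scope.
Context {n : nat}.

Lemma free_gen_prod (x : free_group n) :
  x = \prod_(a <- fg_word x) letter_image (@gen n) a.
Proof.
have consE (b : letter n) (y : free_group n) :
    fg_word (letter_image (@gen n) b * y) = cons_word b (fg_word y).
  by case: b => i [].
apply: val_inj; case: x => w /=; elim: w => [|a w IH] aw; first by rewrite big_nil.
rewrite big_cons consE -(IH (path_sorted aw)).
by case: w aw {IH} => //= b w /andP[/negPf->].
Qed.

Lemma free_morph_id (h : free_group n -> free_group n) :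
  {morph h : x y / x * y} -> (forall i, h (gen i) = gen i) -> h =1 id.
Proof.
move=> hM hg x.
have [h1 hV] := morph_group1V hM.
rewrite [in LHS](free_gen_prod x) [RHS](free_gen_prod x).
elim: (fg_word x) => [|a w IH]; first by rewrite !big_nil.
rewrite !big_cons hM IH; congr (_ * _).
by case: a => i []; rewrite /letter_image /= ?hV hg.
Qed.

End FreeMorphisms.

(** * Transvections *)

Section Transvection.
Local Open Scope group_scope.
Context {n : nat}.

Definition transvect_gen (i : 'I_n) (u : free_group n) (j : 'I_n) : free_group n :=
  if j == i then gen i * u else gen j.

(** The two maps multiply [s_i] by inverse powers of [s_k], which both fix. *)
Lemma transvectK (i k : 'I_n) (u v : free_group n) : k != i ->
    (u, v) = (gen k, (gen k)^-1) \/ (u, v) = ((gen k)^-1, gen k) ->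
  cancel (free_lift (transvect_gen i u)) (free_lift (transvect_gen i v)).
Proof.
move=> ki uv; apply: free_morph_id => [x y|j /=]; first by rewrite !free_liftM.
have fixk w : free_lift (transvect_gen i w) (gen k) = gen k.
  by rewrite free_lift_gen /transvect_gen (negPf ki).
have fixkV w : free_lift (transvect_gen i w) (gen k)^-1 = (gen k)^-1.
  by rewrite (morph_group1V (free_liftM _)).2 fixk.
rewrite free_lift_gen {2}/transvect_gen; case: eqP => [->|/eqP/negPf ji].
  rewrite free_liftM free_lift_gen /transvect_gen eqxx -mulgA.
  by case: uv => [] [-> ->]; rewrite ?fixk ?fixkV ?mulgV ?mulVg mulg1.
by rewrite free_lift_gen /transvect_gen ji.
Qed.

Lemma transvection_exists (i k : 'I_n) : k != i ->
  exists f : autom (free_group n), f (gen i) = gen i * gen k /\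
    forall j, j != i -> f (gen j) = gen j.
Proof.
move=> ki; pose F u := free_lift (transvect_gen i u).
have FP : `[< is_automorphism (F (gen k)) >].
  apply/asboolP; split; first exact: free_liftM.
  by exists (F (gen k)^-1); apply: (transvectK ki); [left|right].
exists (Autom FP); rewrite /= /F free_lift_gen /transvect_gen eqxx; split=> // j ji.
by rewrite free_lift_gen (negPf ji).
Qed.

End Transvection.

(** * Exponent sum *)

Section ExponentSum.
Context {n : nat}.

Definition exponent_sum (x : free_group n) : int :=
  \sum_(a <- fg_word x) (-1) ^+ a.2.

Lemma exponent_sumM x y :
  exponent_sum (x * y)%g = exponent_sum x + exponent_sum y.
Proof.
rewrite /exponent_sum /=; elim: (fg_word x) => [|a u IH] /=.
  by rewrite big_nil add0r.
rewrite big_cons -addrA -IH; case: (mul_word u y) => [|b w] /=.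
  by rewrite big_seq1 big_nil addr0.
case: eqP => [->|_]; last by rewrite big_cons.
by rewrite big_cons /= signrN addrA subrr add0r.
Qed.

Lemma exponent_sum_gen j : exponent_sum (gen j) = 1.
Proof. by rewrite /exponent_sum /= big_seq1. Qed.

Lemma exponent_sumV x : exponent_sum (x^-1)%g = - exponent_sum x.
Proof.
have e1 : exponent_sum (1 : free_group n)%g = 0 := big_nil _ _ _ _.
by have := exponent_sumM x (x^-1)%g; rewrite mulgV e1; lia.
Qed.

Lemma exponent_sumJ x c : exponent_sum (x ^ c)%g = exponent_sum x.
Proof. by rewrite /conjg !exponent_sumM exponent_sumV; lia. Qed.

Lemma exponent_sum_walk (y : lgraph n) (p : seq (edge y)) : edgelet_graph y ->
  (`|exponent_sum (walk_label p)| <= size p)%N.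
Proof.
move=> ey; rewrite /walk_label; elim: p => [|e p IH].
  by rewrite big_nil /exponent_sum big_nil.
rewrite big_cons exponent_sumM /=.
have [j [->|->]] := ey e; move: IH; rewrite ?exponent_sumV exponent_sum_gen;
  set z := exponent_sum _; lia.
Qed.

End ExponentSum.

(** * Counting edgelets *)

Section EdgeletCount.
Context {n : nat}.

Lemma fold_card (x y : lgraph n) : fold x y -> (#|edge x| <= #|edge y| + 2)%N.
Proof.
case=> _ _ _ [e1 [e2 [fV [fE F]]]].
(* [e2] and [erev e2] are the redundant members of the two identified pairs. *)
pose D := [pred a : edge x | (a != e2) && (a != erev e2)].
have fEI : {in D &, injective fE}.
  move=> a b /andP[/negPf a1 /negPf a2] /andP[/negPf b1 /negPf b2] /eqP.
  by rewrite (fold_eqE F) /same_pair a1 a2 b1 b2 !andbF !orbF => /eqP.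
have DC : (#|[predC D]| <= 2)%N.
  apply: (@leq_trans #|[:: e2; erev e2]|); last exact: card_size.
  by apply/subset_leq_card/fintype.subsetP => a; rewrite !inE negb_and !negbK.
by rewrite -(cardC D) leq_add // -(card_in_image fEI) max_card.
Qed.

Lemma isomorphic_card (x y : lgraph n) : isomorphic x y -> #|edge x| = #|edge y|.
Proof. by case=> fV [fE I]; apply: bij_eq_card (iso_bijE I). Qed.

Lemma folding_path_length (phi : Out (free_group n)) (m : nat) (x : nat -> lgraph n) :
  stallings_folding_path phi m x -> (#|edge (x m)| <= 2 * (m + n))%N.
Proof.
case=> _ folds /isomorphic_card x0.
suff H i : (i <= m)%N -> (#|edge (x i)| <= 2 * (i + n))%N by exact: H.
elim: i => [_|i IH im]; first by rewrite x0 card_prod card_ord card_bool; lia.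
by have := fold_card (folds i im); have := IH (ltnW im); lia.
Qed.

(** An edge with label [g] is cut into at least as many edgelets as the exponent
    sum of [g], since each edgelet contributes [1] or [-1]. *)
Lemma subdivision_exponent_sum (x y : lgraph n) (e : edge x) :
  edgelet_subdivision x y -> (`|exponent_sum (lab e)| <= #|edge y|)%N.
Proof.
case=> ey [sV [sE S]]; rewrite -(sub_lab S).
apply: leq_trans (exponent_sum_walk _ ey) _.
(* Every edgelet lies on exactly one edge of [x], exactly once. *)
have -> : size (sE e) = (\sum_(a : edge y) count_mem a (sE e))%N.
  elim: (sE e) => [|b s IH] /=; first by rewrite big1.
  rewrite big_split /= -IH (bigD1 b) //= eqxx big1 // => a /negPf ab.
  by rewrite eq_sym ab.
rewrite -sum1_card; apply: leq_sum => a _; rewrite -(sub_once S a).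
by rewrite (bigD1 e) //= leq_addr.
Qed.

Lemma folding_path_exponent_sum (f : autom (free_group n)) (j : 'I_n) (m : nat)
    (x : nat -> lgraph n) :
  stallings_folding_path (out f) m x ->
  (`|exponent_sum (f (gen j))| <= 2 * (m + n))%N.
Proof.
move=> path; apply: leq_trans (folding_path_length path).
have [[g /out_eqP[c gE] sub] _ _] := path.
have := @subdivision_exponent_sum _ _ ((j, false) : edge (rose g)) sub.
by rewrite /= /rose_lab /= gE exponent_sumJ.
Qed.

End EdgeletCount.

(** * Short automorphisms with long folding paths *)

Lemma word_norm_le (R : realType) (G : groupType) (S : set G) (w : seq G) :
  (forall s, s \in w -> S s \/ S (s^-1)%g) ->
  word_norm R S (\prod_(s <- w) s)%g <= (size w)%:R.
Proof.
move=> wS; apply: ge_inf; last by exists w.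
by exists 0 => r [u [_ _ ->]]; exact: ler0n.
Qed.

(** The automorphism is a power of a product of two transvections whose action
    on [Z^n] is hyperbolic on the plane spanned by two basis vectors. *)
Lemma fast_short_automorphism n (hn : (1 < n)%N) k :
  exists (f : autom (free_group n)) (j : 'I_n),
    (2 ^ k <= `|exponent_sum (f (gen j))|)%N /\
    forall R : realType, out_dist R 1%g (out f) <= (2 * k)%:R.
Proof.
pose i : 'I_n := Ordinal (ltnW hn); pose j : 'I_n := Ordinal hn.
have [t [ti tfix]] := @transvection_exists n i j isT.
have [s [sj sfix]] := @transvection_exists n j i isT.
have tj : t (gen j) = gen j by exact: tfix.
have si : s (gen i) = gen i by exact: sfix.
pose psi : autom (free_group n) := (t * s)%g.
exists (psi ^+ k)%g, i; split.
  (* The exponent sums obey the matrix with rows (1, 1) and (1, 2), whose row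
     sums are at least 2. *)
  suff [ai aj] : (2 ^ k)%:Z <= exponent_sum ((psi ^+ k)%g (gen i)) /\
                 (2 ^ k)%:Z <= exponent_sum ((psi ^+ k)%g (gen j)) by lia.
  elim: k => [|k [IHi IHj]]; first by rewrite !exponent_sum_gen.
  rewrite expgSr !automME si sj ti !automM tj ti !automM.
  move: IHi IHj; rewrite !exponent_sumM expnS.
  move: (exponent_sum _) (exponent_sum _) (2 ^ k)%N => *; lia.
move=> R; pose w l := flatten (nseq l [:: out t; out s]).
have sz l : size (w l) = (2 * l)%N by elim: l => //= l IH; rewrite IH; lia.
have -> : out (psi ^+ k)%g = (\prod_(a <- w k) a)%g.
  elim: k => [|k IH]; first by rewrite big_nil.
  by rewrite expgS outM IH /w /= !big_cons mulgA outM.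
rewrite -sz /out_dist /word_dist invg1 mul1g; apply: word_norm_le => a aw; left.
have : a \in [:: out t; out s].
  by move: aw => /flattenP[l /nseqP[-> _]].
rewrite !inE => /orP[] /eqP->.
  by exists t => //; constructor 1; exists i, j; split.
by exists s => //; constructor 1; exists j, i; split=> // l lj; exact: sfix.
Qed.

Theorem theoremA (R : realType) (n : nat) (hn : (1 < n)%N) (K C : R)
    (hK : 0 < K) (hC : 0 < C) :
  exists phi : Out (free_group n),
    forall (m : nat) (x : nat -> lgraph n) (p : nat -> Out (free_group n)),
      stallings_folding_path phi m x -> induced_path phi m x p ->
      ~ quasi_geodesic (out_dist R (n := n)) K C m p.
Proof.
(* With k := 2 b the quasi-geodesic bound reads 4 ^ b <= 8 b K + 2 C + 2 n,
   whereas 4 ^ b > b ^ 2. *)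
pose b := (Num.bound (8 * K + 2 * C + 2 * n%:R)).+1.
have [f [j [long short]]] := @fast_short_automorphism n hn (2 * b).
exists (out f) => m x p path [p0 pm _] /(_ 0%N m (leq0n m) (leqnn m)) [/andP[+ _]].
rewrite p0 pm sub0r normrN normr_nat ler_pdivrMr // => qg.
have {short} len : m%:R - C <= (2 * (2 * b))%:R * K.
  by apply: le_trans qg _; rewrite ler_pM2r //; apply: short.
have big : (b * b <= 2 * (m + n))%N.
  apply: leq_trans (folding_path_exponent_sum j path); apply: leq_trans long.
  by rewrite mul2n -addnn expnD leq_mul // ltnW // ltn_expl.
have bB : 8 * K + 2 * C + 2 * n%:R < b%:R :> R.
  have b0 : 0 <= 8 * K + 2 * C + 2 * n%:R by have := ler0n R n; lra.
  by apply: lt_trans (archi_boundP b0) _; rewrite ltr_nat.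
have b1 : 1 <= b%:R :> R by rewrite ler1n.
move: big; rewrite -(ler_nat R) !natrM natrD => big.
move: len; rewrite !natrM => len.
have n0 := ler0n R n.
nra.
Qed.
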